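(* Let $G$ be a finite group which has a maximal subgroup that is normal in $G$. Then $\Gamma(G)$ is connected apart from some possible isolated vertices (that is, any two non-isolated vertices of $\Gamma(G)$ are joined by a path in $\Gamma(G)$). Moreover, the diameter of the component formed by the non-isolated vertices is less than or equal to $4$.
   Context: For a group $G$, the co-maximal subgroup graph $\Gamma(G)$ is the simple undirected graph whose vertices are the non-trivial proper subgroups of $G$, two distinct vertices $H,K$ being adjacent if and only if $HK=G$, where $HK=\{hk : h\in H, k\in K\}$. A vertex is isolated if it is adjacent to no other vertex. The diameter is the maximum distance between two vertices. If $\Gamma(G)$ has no edges, the set of non-isolated vertices is empty and the assertion is considered to hold trivially. *)

(* Defs.v *)
From mathcomp Require Import all_boot all_fingroup.

Set Implicit Arguments.
Unset Strict Implicit.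
Unset Printing Implicit Defensive.

Local Open Scope group_scope.

Section Graph.

Variables (T : finType) (e : rel T).

Definition walk_of_length (x y : T) (n : nat) : bool :=
  [exists p : n.-tuple T, path e x p && (last x p == y)].

(* Two joined vertices are joined by a path with fewer than #|T| edges, so the *)
(* value #|T| is taken exactly when y cannot be reached from x.                *)
Definition distance (x y : T) : nat :=
  find (walk_of_length x y) (iota 0 #|T|).

Definition diameter : nat := \max_(x : T) \max_(y : T) distance x y.

Definition non_isolated : {set T} := [set x | [exists y, e x y]].

Definition induced (A : {set T}) : rel {x : T | x \in A} :=
  fun x y => e (val x) (val y).

End Graph.

Arguments induced {T} e A.

Section ComaximalSubgroupGraph.

Variables (gT : finGroupType) (G : {group gT}).

Definition comax_vertex : finType :=
  {H : {group gT} | (H :!=: 1) && (H \proper G)}.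

Definition comax : rel comax_vertex :=
  fun H K => (H != K) && ((val H : {set gT}) * val K == G :> {set gT}).

Lemma comax_irr : irreflexive comax.
Proof. by move=> H; rewrite /comax eqxx. Qed.

Lemma comax_sym : symmetric comax.
Proof.
have sym H K : comax H K -> comax K H.
  case/andP=> nHK /eqP defG; rewrite /comax eq_sym nHK /=.
  have /comm_group_setP <- : group_set (val H * val K) by rewrite defG groupP.
  by rewrite defG.
by move=> H K; apply/idP/idP; apply: sym.
Qed.

End ComaximalSubgroupGraph.

Arguments comax {gT} G.

(* Main.v *)
Require Import Defs.
From mathcomp Require Import all_boot all_fingroup all_solvable.

(** The maximal normal subgroup M is a centre of the graph.  A subgroup H of G
    that is not contained in M satisfies MH = G ([mulg_normal_maximal]), so it
    is adjacent to M.  A subgroup H contained in M has no neighbour inside M,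
    since HK = G with H, K <= M would give G <= M; so if H is not isolated, any
    neighbour K of H lies outside M, and H - K - M is a path.  Hence every
    non-isolated vertex is within distance 2 of M ([comax_center]), and two
    such vertices are within distance 4 of each other, through M.  All the
    vertices of this path are themselves non-isolated, so the bound holds in
    the subgraph that they induce, and connectedness in the whole graph follows
    from connectedness there. *)

Section SymmetricGraph.

Context {T : finType} {e : rel T}.

(** A path at least as long as the number of vertices gives no walk among the
    lengths that [distance] searches; there the bound holds because the search
    returns at most the number of vertices. *)
Lemma distance_leq_size {x y : T} {p : seq T} :
  path e x p -> last x p = y -> distance e x y <= size p.
Proof.
move=> xp lastp; rewrite /distance.
have [ltpT | leTp] := ltnP (size p) #|T|; last first.
  by apply: leq_trans (find_size _ _) _; rewrite size_iota.
rewrite leqNgt; apply/negP=> /(before_find 0); rewrite nth_iota // add0n.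
move=> /negbT/negP; apply; apply/existsP; exists (in_tuple p) => /=.
by rewrite xp lastp eqxx.
Qed.

(** By symmetry the path from y to c can be walked backwards from c to y. *)
Lemma path_through_center {x y c : T} {p q : seq T} :
    symmetric e -> path e x p -> last x p = c -> path e y q -> last y q = c ->
  exists r, [/\ path e x r, last x r = y & size r = size p + size q].
Proof.
move=> sym_e xp lastp yq lastq; exists (p ++ rev (belast y q)).
rewrite cat_path last_cat lastp -lastq size_cat size_rev size_belast xp.
split=> //.
  rewrite rev_path; rewrite (eq_path (e' := e)) // => a b; exact: sym_e.
by case: q {yq lastq} => //= a q; rewrite rev_cons last_rcons.
Qed.

Lemma connect_induced {A : {set T}} {x y : {x : T | x \in A}} :
  connect (induced e A) x y -> connect e (val x) (val y).
Proof.
case/connectP=> p xp ->; apply/connectP; exists (map val p).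
  by rewrite path_map.
by rewrite last_map.
Qed.

End SymmetricGraph.

Section Center.

Context {gT : finGroupType} {G M : {group gT}}.
Hypotheses (maxM : maximal M G) (nMG : (M <| G)%g).

Local Notation non_isolated_vertex :=
  {H : comax_vertex G | H \in non_isolated (comax G)}.

Lemma comax_not_sub (m H : comax_vertex G) :
  val m = M -> ~~ (val H \subset M) -> comax G H m.
Proof.
move=> def_m nHM; rewrite comax_sym /comax def_m; apply/andP; split.
  by apply: contraNneq nHM => <-; rewrite def_m.
have /andP[_ /proper_sub sHG] := valP H.
by rewrite (mulg_normal_maximal nMG maxM).
Qed.

(** Two subgroups of M have their product inside M, which is proper in G.  So a
    vertex below M reaches M through any of its neighbours. *)
Lemma comax_neighbour_not_sub {H K : comax_vertex G} :
  val H \subset M -> comax G H K -> ~~ (val K \subset M).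
Proof.
move=> sHM /andP[_ /eqP defG]; apply/negP=> sKM.
have := proper_subn (maxgroupp maxM).
by rewrite -defG mul_subG.
Qed.

(** The vertex [x0] serves to show that M is itself a non-isolated vertex.  If M
    were trivial, the nontrivial subgroup [x0] would not lie in M, so that
    MH = G with H = [x0] would force H = G, which is absurd.  An edge at [x0]
    then has an end outside M, and that end is adjacent to M. *)
Lemma comax_center (x0 : non_isolated_vertex) :
  exists c : non_isolated_vertex, forall x, exists p,
    [/\ path (induced (comax G) (non_isolated (comax G))) x p, last x p = c
      & size p <= 2].
Proof.
have prMG : M \proper G := maxgroupp maxM.
have ntM : M :!=: 1%g.
  have /andP[ntH prHG] := valP (val x0).
  apply: contraTneq prHG => M1.
  have nHM : ~~ (val (val x0) \subset M).
    by rewrite M1; apply: contra ntH => /trivgP->.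
  apply/negP=> prHG; have := mulg_normal_maximal nMG maxM (proper_sub prHG) nHM.
  by rewrite M1 mul1g => defG; rewrite defG properxx in prHG.
have vM : (M :!=: 1%g) && (M \proper G) by rewrite ntM.
pose m : comax_vertex G := exist _ M vM.
have toM (H : comax_vertex G) : ~~ (val H \subset M) -> comax G H m by apply: comax_not_sub.
have nonisol (H K : comax_vertex G) : comax G H K -> H \in non_isolated (comax G).
  by move=> eHK; rewrite inE; apply/existsP; exists K.
have m_ni : m \in non_isolated (comax G).
  have := valP x0; rewrite inE => /existsP[K eHK].
  have [sHM | nHM] := boolP (val (val x0) \subset M).
    apply: (nonisol m K); rewrite comax_sym.
    exact: toM _ (comax_neighbour_not_sub sHM eHK).
  by apply: (nonisol m (val x0)); rewrite comax_sym toM.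
exists (exist _ m m_ni) => x.
have [sHM | nHM] := boolP (val (val x) \subset M); last first.
  by exists [:: exist _ m m_ni]; rewrite /= /induced toM.
have := valP x; rewrite inE => /existsP[K eHK].
have eKm : comax G K m := toM _ (comax_neighbour_not_sub sHM eHK).
exists [:: exist _ K (nonisol _ _ eKm); exist _ m m_ni].
by rewrite /= /induced /= eHK eKm.
Qed.

Lemma comax_path_size4 (x y : non_isolated_vertex) :
  exists p, [/\ path (induced (comax G) (non_isolated (comax G))) x p,
                last x p = y & size p <= 4].
Proof.
have [c toc] := comax_center x.
have [p [xp lastp szp]] := toc x; have [q [yq lastq szq]] := toc y.
have sym_e : symmetric (induced (comax G) (non_isolated (comax G))).
  by move=> u v; apply: comax_sym.
have [r [xr lastr szr]] := path_through_center sym_e xp lastp yq lastq.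
by exists r; rewrite szr (leq_add szp szq).
Qed.

End Center.

Theorem theorem2p3 (gT : finGroupType) (G : {group gT})
    (hG : exists M : {group gT}, maximal M G /\ (M <| G)%g) :
  (forall H K : comax_vertex G,
     H \in non_isolated (comax G) -> K \in non_isolated (comax G) ->
     connect (comax G) H K)
  /\ diameter (induced (comax G) (non_isolated (comax G))) <= 4.
Proof.
have [M [maxM nMG]] := hG; split=> [H K niH niK |].
  have [p [xp lastp _]] :=
    comax_path_size4 maxM nMG (exist _ H niH) (exist _ K niK).
  by apply: (connect_induced (x := exist _ H niH) (y := exist _ K niK));
    apply/connectP; exists p.
apply/bigmax_leqP=> x _; apply/bigmax_leqP=> y _.
have [p [xp lastp szp]] := comax_path_size4 maxM nMG x y.
exact: leq_trans (distance_leq_size xp lastp) szp.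
Qed.
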